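(* Let $n\ge 2$ and let $Z$ be a proper closed subset of $\mathbb R^n$ that is unbounded in all rational directions. Then the congruence $\mathbf E(Z)$ on $\mathbb T[x_1^{\pm},\ldots,x_n^{\pm}]_{\mathrm{fcn}}$ is not finitely generated.
   Context: The tropical semifield is $\mathbb T=\mathbb R\cup\{-\infty\}$ with addition $a\oplus b=\max\{a,b\}$ and multiplication $a\odot b=a+b$ (additive identity $-\infty$, multiplicative identity $0$). A tropical Laurent polynomial $P=\bigoplus_{\bm u\in\mathbb Z^n}a_{\bm u}\bm x^{\bm u}$ ($a_{\bm u}\in\mathbb T$, all but finitely many equal to $-\infty$) defines the function $\overline P:\mathbb R^n\to\mathbb T$, $\overline P(\bm p)=\max_{\bm u}(a_{\bm u}+\bm u\cdot\bm p)$. $\mathbb T[x_1^{\pm},\ldots,x_n^{\pm}]_{\mathrm{fcn}}$ is the semiring of all such functions under pointwise $\oplus,\odot$. A congruence on a commutative semiring $R$ is an equivalence relation $E\subset R\times R$ closed under coordinatewise addition and multiplication; it is finitely generated if it is the smallest congruence containing some finite subset of $R\times R$. For $Z\subset\mathbb R^n$, $\mathbf E(Z)=\{(f,g) : f,g\in\mathbb T[x_1^{\pm},\ldots,x_n^{\pm}]_{\mathrm{fcn}},\ f|_Z=g|_Z\}$, a congruence. A subset $Z\subset\mathbb R^n$ is unbounded in all rational directions if for every $\bm u\in\mathbb Z^n\setminus\{\mathbf 0\}$ the set $\{\bm p\cdot\bm u : \bm p\in Z\}\subset\mathbb R$ is not bounded above, where $\cdot$ is the standard inner product. *)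

(* Defs.v *)
From HB Require Import structures.
From mathcomp Require Import all_boot all_order all_algebra.
From mathcomp Require Import finmap.
From mathcomp Require Import all_classical all_reals all_analysis.

Set Implicit Arguments.
Unset Strict Implicit.
Unset Printing Implicit Defensive.

Import Order.TTheory GRing.Theory Num.Theory.
Local Open Scope classical_set_scope.
Local Open Scope ring_scope.

Section Congruences.
Variable S : comPzSemiRingType.
Implicit Types E G : set (S * S).

Record is_congruence E : Prop := IsCongruence {
  congr_refl : forall a, E (a, a);
  congr_sym : forall a b, E (a, b) -> E (b, a);
  congr_trans : forall a b c, E (a, b) -> E (b, c) -> E (a, c);
  congr_add : forall a b c d, E (a, b) -> E (c, d) -> E (a + c, b + d);
  congr_mul : forall a b c d, E (a, b) -> E (c, d) -> E (a * c, b * d) }.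

Lemma is_congruence_smallest G : is_congruence (smallest is_congruence G).
Proof.
split.
- by move=> a E [cE _]; exact: congr_refl.
- by move=> a b H E EG; apply: (congr_sym EG.1); exact: H.
- by move=> a b c H K E EG; apply: (congr_trans EG.1 (H _ EG)); exact: K.
- by move=> a b c d H K E EG; apply: (congr_add EG.1); [exact: H|exact: K].
- by move=> a b c d H K E EG; apply: (congr_mul EG.1); [exact: H|exact: K].
Qed.

Definition finitely_generated E : Prop :=
  exists2 G : set (S * S), finite_set G & E = smallest is_congruence G.

End Congruences.

(* [None] is -oo. In the semiring structure on [tropical R], the generic
   notations [+], [*], [0], [1] denote max, the sum of reals, -oo and [Some 0]
   respectively, and [\sum] is an iterated max. *)
Definition tropical (R : realType) : Type := option R.

Section Tropical.
Variable R : realType.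
Local Notation T := (tropical R).
Implicit Types a b c : T.

HB.instance Definition _ := Choice.copy T (option R).

Definition trop_add a b : T :=
  match a, b with
  | Some x, Some y => Some (Num.max x y)
  | None, _ => b
  | _, None => a
  end.

Definition trop_mul a b : T :=
  match a, b with
  | Some x, Some y => Some (x + y)
  | _, _ => None
  end.

Fact trop_addA : associative trop_add.
Proof. by move=> [x|] [y|] [z|] //=; rewrite maxA. Qed.

Fact trop_addC : commutative trop_add.
Proof. by move=> [x|] [y|] //=; rewrite maxC. Qed.

Fact trop_add0 : left_id None trop_add.
Proof. by case. Qed.

HB.instance Definition _ :=
  GRing.isNmodule.Build T trop_addA trop_addC trop_add0.

Fact trop_mulA : associative trop_mul.
Proof. by move=> [x|] [y|] [z|] //=; rewrite addrA. Qed.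

Fact trop_mulC : commutative trop_mul.
Proof. by move=> [x|] [y|] //=; rewrite addrC. Qed.

Fact trop_mul1 : left_id (Some 0) trop_mul.
Proof. by case=> //= x; rewrite add0r. Qed.

Fact trop_mulDl : left_distributive trop_mul (+%R : T -> T -> T).
Proof.
by move=> [x|] [y|] [z|] //; rewrite /GRing.add /= addr_maxl.
Qed.

Fact trop_mul0 : left_zero (0 : T) trop_mul.
Proof. by case. Qed.

Fact trop_one_neq0 : (Some 0 : T) != 0.
Proof. by []. Qed.

HB.instance Definition _ := GRing.Nmodule_isComNzSemiRing.Build T
  trop_mulA trop_mulC trop_mul1 trop_mulDl trop_mul0 trop_one_neq0.

End Tropical.

Definition dotp (R : realType) n (x y : 'rV[R]_n) : R :=
  \sum_(i < n) x 0 i * y 0 i.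

(* A named copy of the function type, so that the pointwise semiring structure
   does not compete with the library's instances on [_ -> _]. *)
Definition tropical_map (R : realType) (n : nat) : Type :=
  'rV[R]_n -> tropical R.

Section TropicalMaps.
Variables (R : realType) (n : nat).
Local Notation F := (tropical_map R n).
Implicit Types f g h : F.

HB.instance Definition _ := Choice.copy F ('rV[R]_n -> tropical R).

Definition tmap_add f g : F := fun p => f p + g p.
Definition tmap_mul f g : F := fun p => f p * g p.

Fact tmap_addA : associative tmap_add.
Proof. by move=> f g h; apply/funext => p; exact: addrA. Qed.

Fact tmap_addC : commutative tmap_add.
Proof. by move=> f g; apply/funext => p; exact: addrC. Qed.

Fact tmap_add0 : left_id (fun=> 0) tmap_add.
Proof. by move=> f; apply/funext => p; exact: add0r. Qed.

HB.instance Definition _ :=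
  GRing.isNmodule.Build F tmap_addA tmap_addC tmap_add0.

Fact tmap_mulA : associative tmap_mul.
Proof. by move=> f g h; apply/funext => p; exact: mulrA. Qed.

Fact tmap_mulC : commutative tmap_mul.
Proof. by move=> f g; apply/funext => p; exact: mulrC. Qed.

Fact tmap_mul1 : left_id (fun=> 1) tmap_mul.
Proof. by move=> f; apply/funext => p; exact: mul1r. Qed.

Fact tmap_mulDl : left_distributive tmap_mul (+%R : F -> F -> F).
Proof. by move=> f g h; apply/funext => p; exact: mulrDl. Qed.

Fact tmap_mul0 : left_zero (0 : F) tmap_mul.
Proof. by move=> f; apply/funext => p; exact: mul0r. Qed.

Fact tmap_one_neq0 : ((fun=> 1) : F) != 0.
Proof. by apply/eqP => /(congr1 (@^~ 0)). Qed.

HB.instance Definition _ := GRing.Nmodule_isComNzSemiRing.Build F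
  tmap_mulA tmap_mulC tmap_mul1 tmap_mulDl tmap_mul0 tmap_one_neq0.

Lemma tmap_addE f g p : (f + g) p = f p + g p. Proof. by []. Qed.

Lemma tmap_mulE f g p : (f * g) p = f p * g p. Proof. by []. Qed.

Lemma tmap_sumE (I : Type) (s : seq I) (G : I -> F) p :
  (\sum_(i <- s) G i) p = \sum_(i <- s) G i p.
Proof. by elim/big_rec2: _ => // i _ x _ <-; rewrite tmap_addE. Qed.

End TropicalMaps.

(* Finitely supported families of coefficients, indexed by exponents in Z^n. *)
Definition tropical_laurent (R : realType) (n : nat) : Type :=
  {fsfun 'rV[int]_n -> tropical R with 0}.

Section LaurentFunctions.
Variables (R : realType) (n : nat).
Local Notation T := (tropical R).
Local Notation F := (tropical_map R n).

Definition monomial_map (u : 'rV[int]_n) : F :=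
  fun p => Some (dotp (map_mx intr u) p).

Definition laurent_eval (P : tropical_laurent R n) : F :=
  fun p => \sum_(u <- finsupp P) P u * monomial_map u p.

Definition laurent_map : {pred F} :=
  fun f => `[< exists P : tropical_laurent R n, f = laurent_eval P >].

Lemma laurent_map_sum f :
  reflect (exists s : seq ('rV[int]_n * T),
             f = \sum_(t <- s) (fun p => t.2 * monomial_map t.1 p))
          (f \in laurent_map).
Proof.
apply: (iffP (asboolP _)) => [[P ->]|[s ->]].
  exists [seq (u, P u) | u <- finsupp P].
  by apply/funext => p; rewrite tmap_sumE big_map.
pose c u : T := \sum_(t <- s | t.1 == u) t.2.
pose X : {fset 'rV[int]_n} := [fset t.1 | t in s]%fset.
pose P : tropical_laurent R n := [fsfun u in X => c u | 0].
have PE u : P u = c u.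
  rewrite fsfunE; case: ifPn => // uX; rewrite /c big_seq_cond big1// => t.
  by case/andP => ts /eqP tu; case/imfsetP: uX; exists t.
exists P; apply/funext => p; rewrite tmap_sumE /laurent_eval.
transitivity (\sum_(u <- X) P u * monomial_map u p); last first.
  apply/esym/big_fset_incl; first exact: finsupp_sub.
  by move=> u _ /fsfun_dflt ->; rewrite mul0r.
under [RHS]eq_bigr do rewrite PE mulr_suml.
rewrite (exchange_big_dep predT)//= big_seq [RHS]big_seq.
apply: eq_bigr => t ts.
rewrite big_mkcond (big_fsetD1 t.1)/=; last by apply/imfsetP; exists t.
rewrite eqxx big1_fset ?addr0// => u; rewrite !inE => /andP[ut _] _.
by rewrite eq_sym (negPf ut).
Qed.

Lemma monomial_map0 : monomial_map 0 = 1.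
Proof.
apply/funext => p; rewrite /monomial_map /dotp map_mx0 big1//.
by move=> i _; rewrite mxE mul0r.
Qed.

Lemma monomial_mapD u v :
  monomial_map (u + v) = monomial_map u * monomial_map v.
Proof.
apply/funext => p; rewrite tmap_mulE /monomial_map /dotp map_mxD.
congr Some; rewrite -big_split/=.
by apply: eq_bigr => i _; rewrite !mxE mulrDl.
Qed.

Fact laurent_map_semiring_closed : semiring_closed laurent_map.
Proof.
split; split.
- by apply/laurent_map_sum; exists [::]; rewrite big_nil.
- move=> _ _ /laurent_map_sum[s ->] /laurent_map_sum[t ->].
  by apply/laurent_map_sum; exists (s ++ t); rewrite big_cat.
- apply/laurent_map_sum; exists [:: (0, 1)]; rewrite big_seq1 /= monomial_map0.
  by apply/funext => p; rewrite mul1r.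
- move=> _ _ /laurent_map_sum[s ->] /laurent_map_sum[t ->].
  apply/laurent_map_sum.
  exists [seq (a.1 + b.1, a.2 * b.2) | a <- s, b <- t].
  rewrite big_allpairs_dep/= mulr_suml; apply: eq_bigr => a _.
  rewrite mulr_sumr; apply: eq_bigr => b _.
  by apply/funext => p; rewrite tmap_mulE monomial_mapD tmap_mulE mulrACA.
Qed.

Record laurent_fcn : Type := LaurentFcn {
  laurent_fcn_val : F;
  _ : laurent_fcn_val \in laurent_map }.

Definition laurent_fcn_app (f : laurent_fcn) : 'rV[R]_n -> T :=
  laurent_fcn_val f.
Coercion laurent_fcn_app : laurent_fcn >-> Funclass.

HB.instance Definition _ := [isSub for laurent_fcn_val].
HB.instance Definition _ := [Choice of laurent_fcn by <:].
HB.instance Definition _ := GRing.SubChoice_isSubComNzSemiRing.Build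
  F laurent_map laurent_fcn laurent_map_semiring_closed.

Lemma laurent_fcn_addE (f g : laurent_fcn) p :
  (f + g : laurent_fcn) p = f p + g p.
Proof. by []. Qed.

Lemma laurent_fcn_mulE (f g : laurent_fcn) p :
  (f * g : laurent_fcn) p = f p * g p.
Proof. by []. Qed.

Definition congruence_of (Z : set 'rV[R]_n) : set (laurent_fcn * laurent_fcn) :=
  [set fg : laurent_fcn * laurent_fcn | forall p, Z p -> fg.1 p = fg.2 p].

Lemma is_congruence_congruence_of Z : is_congruence (congruence_of Z).
Proof.
split=> //.
- by move=> f g H p Zp; rewrite H.
- by move=> f g h H K p Zp; rewrite H// K.
- by move=> f g h k H K p Zp; exact: (congr2 +%R (H p Zp) (K p Zp)).
- by move=> f g h k H K p Zp; exact: (congr2 *%R (H p Zp) (K p Zp)).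
Qed.

Definition unbounded_in_all_rational_directions (Z : set 'rV[R]_n) : Prop :=
  forall u : 'rV[int]_n, u != 0 ->
    ~ has_ubound [set dotp p (map_mx intr u) | p in Z].

End LaurentFunctions.

(* Main.v *)
Require Import Defs.
From mathcomp Require Import all_boot all_order all_algebra.
From mathcomp Require Import finmap zify lra.
From mathcomp Require Import all_classical all_reals all_analysis.

Import Order.TTheory GRing.Theory Num.Theory.
Import numFieldNormedType.Exports.
Local Open Scope classical_set_scope.
Local Open Scope ring_scope.

(* Suppose E(Z) is generated by finitely many pairs (a, b).  As Z lies in no
   rational half-space, a <> b forces a to involve two distinct exponents.
   Pick p0 outside Z and let f(p) = max_{u in U} u . (p - p0), where U is a
   symmetric set of exponents with 0 in the interior of its hull; then
   g = max(f, eps) agrees with f on Z for small eps > 0, while g(p0) <> f(p0).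
   As n >= 2, U can be chosen so thin in some integral direction rho that no
   translate of two exponents of a generator fits in its hull.  Then
   c a + e = f forces c = 0, so no elementary step leaves f: the congruence
   class of f is a singleton, although (f, g) is in E(Z). *)

Set Implicit Arguments.
Unset Strict Implicit.

(* This is the largest congruence for which {f} is a class. *)
Lemma syntactic_is_congruence (S : comPzSemiRingType) (f : S) :
  is_congruence [set ab : S * S |
    forall c e, c * ab.1 + e = f <-> c * ab.2 + e = f].
Proof.
split=> //=.
- by move=> a b H c e; split=> /H.
- by move=> a b c H K x e; split=> [/H/K|/K/H].
- move=> a b c d H K x e; apply: (@iff_trans _ (x * b + x * c + e = f)).
    by rewrite mulrDr -!addrA; exact: H.
  by rewrite mulrDr !(addrC (x * b)) -!addrA; exact: K.
- move=> a b c d H K x e; apply: (@iff_trans _ (x * b * c + e = f)).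
    by rewrite mulrA !(mulrAC x _ c); exact: H.
  by rewrite mulrA; apply: K.
Qed.

(** * Bounds for finite tropical sums *)

Section TropicalSums.
Context {R : realType}.
Implicit Types I : eqType.

Lemma trop_sum_ge I (s : seq I) (F : I -> tropical R) i x :
  i \in s -> F i = Some x -> exists2 y, \sum_(j <- s) F j = Some y & x <= y.
Proof.
move=> si Fi; rewrite (big_rem i)//= Fi.
case: (\sum_(_ <- _) _) => [z|]; last by exists x.
by exists (Num.max x z) => //; rewrite le_max lexx.
Qed.

Lemma trop_sum_le I (s : seq I) (F : I -> tropical R) (t y : R) :
  (forall i x, i \in s -> F i = Some x -> x <= t) ->
  \sum_(j <- s) F j = Some y -> y <= t.
Proof.
elim: s y => [|i s IH] y Ft; first by rewrite big_nil.
rewrite big_cons.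
have {}IH z : \sum_(j <- s) F j = Some z -> z <= t.
  by apply: IH => j x sj; apply: Ft; rewrite inE sj orbT.
case Fi: (F i) => [x|]; last by rewrite [LHS]add0r => /IH.
have xt : x <= t by apply: Ft Fi; rewrite inE eqxx.
case: (\sum_(_ <- _) _) IH => [z|] IH [<-] //.
by rewrite ge_max xt IH.
Qed.

End TropicalSums.

(** * The inner product *)

Section Dotp.
Context {R : realType} {n : nat}.
Implicit Types (u v : 'rV[int]_n) (p q : 'rV[R]_n).

Lemma dotpDl (x y p : 'rV[R]_n) : dotp (x + y) p = dotp x p + dotp y p.
Proof.
by rewrite -big_split/=; apply: eq_bigr => i _; rewrite mxE mulrDl.
Qed.

Lemma dotpZl a (x p : 'rV[R]_n) : dotp (a *: x) p = a * dotp x p.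
Proof. by rewrite mulr_sumr; apply: eq_bigr => i _; rewrite mxE mulrA. Qed.

Lemma dotpC (x y : 'rV[R]_n) : dotp x y = dotp y x.
Proof. by apply: eq_bigr => i _; rewrite mulrC. Qed.

Lemma dotpNl (x p : 'rV[R]_n) : dotp (- x) p = - dotp x p.
Proof. by rewrite -scaleN1r dotpZl mulN1r. Qed.

Lemma dotp_int u v :
  dotp (map_mx intr u) (map_mx intr v) = (\sum_i u 0 i * v 0 i)%:~R :> R.
Proof. by rewrite rmorph_sum; apply: eq_bigr => i _; rewrite !mxE rmorphM. Qed.

End Dotp.

(** * Exponents of Laurent functions *)

Section Terms.
Context {R : realType} {n : nat}.
Implicit Types (u v w : 'rV[int]_n) (p q : 'rV[R]_n) (a b c e : laurent_fcn R n).
Local Notation intv := (map_mx (intr : int -> R)).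

(** Different Laurent polynomials can define the same function, so exponents are replaced by a
    condition on values alone: [u] lies in the Newton polytope of [a]. *)
Definition dominates_monomial a u : Prop := exists k : R, forall p,
  exists2 y, a p = Some y & k + dotp (intv u) p <= y.

Lemma laurent_fcn_evalP a : exists P : tropical_laurent R n,
  forall p, a p = \sum_(u <- finsupp P) P u * monomial_map u p.
Proof.
by case: a => f fP; have /asboolP[P fE] := fP; exists P => p; exact: (congr1 (@^~ p) fE).
Qed.

Lemma finsupp_Some (P : tropical_laurent R n) u :
  u \in finsupp P -> exists x, P u = Some x.
Proof. by rewrite mem_finsupp; case: (P u) => // x _; exists x. Qed.

Lemma dominates_finsupp a (P : tropical_laurent R n) u :
  (forall p, a p = \sum_(u <- finsupp P) P u * monomial_map u p) ->
  u \in finsupp P -> dominates_monomial a u.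
Proof.
move=> aP uP; have [x Pu] := finsupp_Some uP; exists x => p; rewrite aP.
by apply: trop_sum_ge uP _; rewrite Pu.
Qed.

Lemma dominates_mul c a v u : dominates_monomial c v ->
  dominates_monomial a u -> dominates_monomial (c * a) (v + u).
Proof.
move=> [k ck] [l al]; exists (k + l) => p.
have [x cx kx] := ck p; have [y ay ly] := al p.
exists (x + y); first by rewrite laurent_fcn_mulE cx ay.
by rewrite map_mxD dotpDl addrACA lerD.
Qed.

Lemma dominates_add a e u :
  dominates_monomial a u -> dominates_monomial (a + e) u.
Proof.
move=> [k ak]; exists k => p; have [y ay ky] := ak p.
rewrite laurent_fcn_addE ay; case: (e p) => [z|]; last by exists y.
by exists (Num.max y z) => //; rewrite le_max ky.
Qed.

Lemma laurent_fcn_ext a b : (forall p, a p = b p) -> a = b.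
Proof. by move=> ab; apply/val_inj/funext. Qed.

Lemma dominates_nonzero c : c <> 0 -> exists v, dominates_monomial c v.
Proof.
have [P cP] := laurent_fcn_evalP c; move=> c0.
have [P0|[v vP]] := fset_0Vmem (finsupp P); last first.
  by exists v; exact: dominates_finsupp vP.
by exfalso; apply: c0; apply: laurent_fcn_ext => p; rewrite cP P0 big_nil.
Qed.

(** If [a] involves at most one exponent [w], any exponent [u] of [b] has [u - w] bounded above on
    [Z], so [u = w]; then agreement at one point of [Z] gives [a = b]. *)
Lemma dominates_two (Z : set 'rV[R]_n) a b :
  (0 < n)%N -> unbounded_in_all_rational_directions Z ->
  congruence_of Z (a, b) -> a <> b ->
  exists u v, [/\ u != v, dominates_monomial a u & dominates_monomial a v].
Proof.
move=> n_gt0 Zu Eab; apply: contra_notP => Na.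
(* An empty [Z] would be bounded above in the nonzero direction (1, ..., 1). *)
have [z Zz] : Z !=set0.
  apply/set0P; apply: contra_notN (Zu (const_mx 1) _) => [/eqP ->|].
    by exists 0 => x [p []].
  apply/eqP => /matrixP/(_ 0 (Ordinal n_gt0)).
  by rewrite !mxE.
have [P aP] := laurent_fcn_evalP a; have [Q bQ] := laurent_fcn_evalP b.
have [w Pw] : exists w, forall u, u \in finsupp P -> u = w.
  have [->|[w wP]] := fset_0Vmem (finsupp P); first by exists 0.
  exists w => u uP; apply/eqP/negPn/negP => uw; apply: Na; exists u, w.
  by split=> //; exact: dominates_finsupp aP _.
have Qw u : u \in finsupp Q -> u = w.
  move=> /(dominates_finsupp bQ)[k bk].
  apply/eqP/negPn/negP; rewrite -subr_eq0 => /Zu; apply.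
  (* If [P w] is -oo, then so is [a z], whereas [b z] is finite because [b] dominates a monomial. *)
  case PwE : (P w) => [x|]; last first.
    have [y yE _] := bk z; move: yE; rewrite -(Eab z Zz)/= aP big1_seq// => u' /andP[_ /Pw ->].
    by rewrite PwE.
  exists (x - k) => _ [p Zp <-].
  have [y yE ky] := bk p; move: yE; rewrite -(Eab p Zp)/= aP => yE.
  have : y <= x + dotp (intv w) p.
    apply: trop_sum_le yE => u' t /Pw ->.
    by rewrite PwE => -[<-].
  rewrite map_mxB (dotpC p) dotpDl dotpNl; lra.
have single (T : tropical_laurent R n) p : (forall u, u \in finsupp T -> u = w) ->
    \sum_(u <- finsupp T) T u * monomial_map u p = T w * monomial_map w p.
  move=> Tw; have [wT|wT] := boolP (w \in finsupp T).
    rewrite (big_fsetD1 w)//= big1_fset ?addr0// => u.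
    by rewrite !inE => /andP[/eqP uw /Tw].
  rewrite big1_seq => [|u /andP[_ uT]]; first by rewrite fsfun_dflt// mul0r.
  by rewrite -(Tw _ uT) uT in wT.
have PQ : P w = Q w.
  have := Eab z Zz; rewrite /= aP bQ !single//.
  by case: (P w) (Q w) => [x|] [y|] //= [] /addIr ->.
by apply: laurent_fcn_ext => p; rewrite aP bQ !single// PQ.
Qed.

End Terms.

(** * An integral functional that is large on short nonzero vectors *)

Lemma base_expansion_eq0 (K : nat) m (d : nat -> int) :
  (forall i, `|d i| <= K%:Z) ->
  \sum_(i < m) K.+1%:Z ^+ i * d i = 0 -> forall i, (i < m)%N -> d i = 0.
Proof.
elim: m d => // m IH d dK; rewrite big_ord_recl expr0 mul1r.
under eq_bigr do rewrite lift0 exprS -mulrA.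
rewrite -mulr_sumr; set s := \sum_(_ < _) _ => ds.
(* Here [d 0] is a multiple of K + 1 of absolute value at most K. *)
have s0 : s = 0.
  by have := dK 0; rewrite ler_norml => /andP[]; move: (d 0) s ds; nia.
have d0 : d 0 = 0 by rewrite s0 mulr0 addr0 in ds.
by case=> // i; apply: (IH (fun i => d i.+1)).
Qed.

(* The functional is e_1 + M r with r = (1, N, N^2, ...): for N large r does not
   vanish on d, and for M large the second summand dominates; it takes the
   value 1 on w = e_1 - N e_0. *)
Lemma primitive_functional (n K : nat) : exists rho w : 'rV[int]_n.+2,
  \sum_i rho 0 i * w 0 i = 1 /\
  forall d : 'rV[int]_n.+2, d != 0 -> (forall i, `|d 0 i| <= K%:Z) ->
    3 <= `|\sum_i rho 0 i * d 0 i|.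
Proof.
pose i1 : 'I_n.+2 := lift ord0 ord0.
(* N exceeds every digit |d_i|, so r . d is a nonzero integer; then |M (r . d) + d_1| >= (K + 3) - K
   = 3. *)
pose M := (K + 3)%:Z; pose N := K.+1%:Z.
pose rho : 'rV[int]_n.+2 := \row_i ((i == i1)%:Z + M * N ^+ i).
have rhoE (d : 'rV[int]_n.+2) :
    \sum_i rho 0 i * d 0 i = d 0 i1 + M * \sum_(i < n.+2) N ^+ i * d 0 i.
  rewrite mulr_sumr (eq_bigr (fun i : 'I_n.+2 => (i == i1)%:Z * d 0 i + M * (N ^+ i * d 0 i))).
    rewrite big_split/=; congr (_ + _); rewrite (bigD1 i1)// eqxx mul1r big1.
      exact: addr0.
    by move=> i /negPf ->; rewrite mul0r.
  by move=> i _; rewrite mxE mulrDl mulrA.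
exists rho, (\row_i ((i == i1)%:Z - N * (i == 0)%:Z)); split.
  rewrite rhoE !big_ord_recl big1 => [|i _]; rewrite !mxE /=.
    rewrite /= expr0 /bump /= expr1; lia.
  by rewrite !mulr0.
move=> d d0 dK; rewrite rhoE.
have : \sum_(i < n.+2) N ^+ i * d 0 i != 0.
  apply: contra d0 => /eqP s0; apply/eqP/rowP => i; rewrite mxE.
  have := @base_expansion_eq0 K n.+2 (fun j => d 0 (inord j)) (fun j => dK _).
  move=> /(_ _ i (ltn_ord i)); rewrite inord_val; apply.
  by rewrite -[RHS]s0; apply: eq_bigr => j _; rewrite inord_val.
have := dK i1; rewrite /M; set s := \sum_i _; nia.
Qed.

(** * The thin cross-polytope and its support function *)

Section Bump.
Context {R : realType} {n : nat}.
Implicit Types (p q : 'rV[R]_n) (S : seq 'rV[int]_n).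
Local Notation intv := (map_mx (intr : int -> R)).

(* A lattice cross-polytope: 0 is an interior lattice point of the hull of
   S and -S, which has width at most 2 in the direction rho. *)
Lemma thin_cross_polytope (rho w : 'rV[int]_n) : \sum_i rho 0 i * w 0 i = 1 ->
  exists S, [/\ S != [::],
    forall u, u \in S -> `|\sum_i rho 0 i * u 0 i| <= 1 &
    exists2 L : R, 0 < L & forall (t : R) q,
      (forall u, u \in S -> `|dotp (intv u) q| < t) ->
      forall j, `|q 0 j| < L * t].
Proof.
(* [k j] is the projection of the basis vector e_j to the kernel of [rho] along [w], so [rho] is 1
   on [w] and 0 on every [k j]. *)
move=> rw1; pose k j : 'rV[int]_n := delta_mx 0 j - rho 0 j *: w.
exists (w :: [seq k j | j <- enum 'I_n]); split=> //.
  move=> u; rewrite inE => /predU1P[->|/mapP[j _ ->]]; first by rewrite rw1.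
  rewrite (eq_bigr (fun i : 'I_n => rho 0 i * (i == j)%:Z - rho 0 j * (rho 0 i * w 0 i))).
    suff -> : \sum_i (rho 0 i * (i == j)%:Z - rho 0 j * (rho 0 i * w 0 i)) = 0.
      by [].
    rewrite sumrB -mulr_sumr rw1 mulr1; apply/eqP; rewrite subr_eq0; apply/eqP.
    rewrite (bigD1 j)// eqxx mulr1 big1; first exact: addr0.
    by move=> i /negPf ->; rewrite mulr0.
  move=> i _; rewrite !mxE eqxx/= mulrBr (mulrCA _ (rho 0 j)); congr (_ * _ - _).
  by case: (i == j).
(* From e_j = k_j + rho_j w, the coordinate q_j is less than (1 + |rho_j|) t in absolute value; the
   sum makes this uniform in j. *)
exists (1 + \sum_j `|(rho 0 j)%:~R : R|).
  by rewrite ltr_wpDr// sumr_ge0.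
move=> t q qt j.
have wt : `|dotp (intv w) q| < t by apply: qt; rewrite inE eqxx.
have kt : `|dotp (intv (k j)) q| < t.
  by apply: qt; rewrite inE map_f ?orbT// mem_enum.
have -> : q 0 j = dotp (intv (k j)) q + (rho 0 j)%:~R * dotp (intv w) q.
  rewrite -dotpZl -dotpDl /dotp (bigD1 j)//= big1 => [|i /negPf ij].
    by rewrite !mxE !eqxx /= intrB intrM subrK mul1r addr0.
  by rewrite !mxE ij/= intrB intrM sub0r addNr mul0r.
apply: le_lt_trans (ler_normD _ _) _; rewrite mulrDl mul1r ltr_leD// normrM.
apply: ler_pM => //; last exact: ltW.
by rewrite (bigD1 j)//= lerDl sumr_ge0.
Qed.

(* shifted_sum p0 S p is the maximum of |u . (p - p0)| over u in S. *)
Definition shifted_sum (p0 : 'rV[R]_n) S : tropical_map R n :=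
  \sum_(t <- [seq (u, Some (- dotp (intv u) p0) : tropical R) | u <- S ++ map -%R S])
    (fun p => t.2 * monomial_map t.1 p).

Lemma shifted_sum_in p0 S : shifted_sum p0 S \in @laurent_map R n.
Proof. by apply/laurent_map_sum; eexists. Qed.

Definition cross_fcn p0 S : laurent_fcn R n := LaurentFcn (shifted_sum_in p0 S).

Definition const_fcn_map (k : R) : tropical_map R n := fun=> Some k.

Lemma const_fcn_in k : const_fcn_map k \in @laurent_map R n.
Proof.
apply/laurent_map_sum; exists [:: (0, Some k)]; rewrite big_seq1/=.
by apply/funext => p; rewrite monomial_map0 [RHS]mulr1.
Qed.

Definition const_fcn k : laurent_fcn R n := LaurentFcn (const_fcn_in k).

Lemma cross_fcnE p0 S p : cross_fcn p0 S p =
  \sum_(u <- S ++ map -%R S) (Some (dotp (intv u) (p - p0)) : tropical R).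
Proof.
rewrite /cross_fcn/= /laurent_fcn_app/= /shifted_sum big_map tmap_sumE.
apply: eq_bigr => u _ /=; congr Some.
by rewrite [in RHS]dotpC dotpDl dotpNl !(dotpC _ (intv u)) addrC.
Qed.

Lemma cross_fcn_ge p0 S p u : u \in S ->
  exists2 y, cross_fcn p0 S p = Some y & `|dotp (intv u) (p - p0)| <= y.
Proof.
move=> uS; rewrite cross_fcnE.
have [y yE uy] : exists2 y, \sum_(u <- S ++ map -%R S)
    (Some (dotp (intv u) (p - p0)) : tropical R) = Some y &
    dotp (intv u) (p - p0) <= y.
  by apply: (@trop_sum_ge _ _ _ _ u) => //; rewrite mem_cat uS.
exists y => //; rewrite ler_norml uy andbT lerNl -dotpNl -map_mxN.
have [|z] := @trop_sum_ge R _ (S ++ map -%R S)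
  (fun u => Some (dotp (intv u) (p - p0))) (- u) _ _ erefl.
  by rewrite mem_cat map_f ?orbT.
by rewrite yE => -[->].
Qed.

Lemma cross_fcn_le p0 S p t y :
  (forall u, u \in S -> `|dotp (intv u) (p - p0)| <= t) ->
  cross_fcn p0 S p = Some y -> y <= t.
Proof.
move=> St; rewrite cross_fcnE; apply: trop_sum_le => u x.
rewrite mem_cat => /orP[uS [<-]|/mapP[v vS -> [<-]]].
  exact: le_trans (ler_norm _) (St _ uS).
by rewrite map_mxN dotpNl; apply: le_trans (ler_norm _) _; rewrite normrN St.
Qed.

(** On the line p0 + t rho the function is at most |t|, as |rho . w| <= 1 for w in [S]. Hence a
    dominated exponent has slope at most 1 in both directions. *)
Lemma cross_fcn_dominates p0 S (rho u v : 'rV[int]_n) :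
  (forall u, u \in S -> `|\sum_i rho 0 i * u 0 i| <= 1) ->
  dominates_monomial (cross_fcn p0 S) u ->
  dominates_monomial (cross_fcn p0 S) v ->
  `|\sum_i rho 0 i * (u - v) 0 i| <= 2.
Proof.
move=> Srho.
wlog suff: u v / dominates_monomial (cross_fcn p0 S) u ->
    dominates_monomial (cross_fcn p0 S) v ->
    \sum_i rho 0 i * (u - v) 0 i <= 2.
  move=> H uf vf; rewrite ler_norml H// andbT lerNl -sumrN.
  rewrite (eq_bigr (fun i => rho 0 i * (v - u) 0 i)) ?H// => i _.
  by rewrite -mulrN !mxE opprB.
have bound (x : R) z : `|x| = 1 -> dominates_monomial (cross_fcn p0 S) z ->
    exists k : R, forall t, 0 <= t ->
      k + t * x * dotp (intv rho) (intv z) <= t.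
  move=> x1 [k kz]; exists (k + dotp (intv z) p0) => t t0.
  have [y yE] := kz (p0 + (t * x) *: intv rho).
  rewrite dotpC dotpDl dotpZl addrA (dotpC p0).
  move=> /le_trans; apply; apply: cross_fcn_le yE => w wS.
  rewrite [_ - p0]addrC addKr dotpC dotpZl normrM normrM x1 mulr1 ger0_norm//.
  rewrite -[leRHS]mulr1 ler_wpM2l// dotp_int -intr_norm.
  by rewrite (ler_int R _ 1) Srho.
move=> /(bound 1 _ (normr1 _))[k ku].
move=> /(bound (-1) _ (normrN1 _))[l lv].
rewrite leNgt; apply/negP => d3.
have {}d3 : 3 <= dotp (intv rho) (intv u) - dotp (intv rho) (intv v).
  rewrite !dotp_int -intrB -sumrB (ler_int R 3).
  rewrite (eq_bigr (fun i => rho 0 i * (u - v) 0 i)) => [|i _]; last first.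
    by rewrite -mulrBr !mxE.
  by move: d3; set x := \sum_i _; lia.
(* Adding the bounds for [u] and [v] gives k + l + 3 t <= 2 t, which fails at this [t]. *)
have [t tE] : exists t : R, t = `|k| + `|l| + 1 by eexists.
have t0 : 0 <= t by rewrite tE !addr_ge0.
have := ku t t0; have := lv t t0.
have := ler_norm (- k); have := ler_norm (- l); rewrite !normrN.
have : t * 3 <= t * (dotp (intv rho) (intv u) - dotp (intv rho) (intv v)).
  by rewrite ler_wpM2l.
rewrite mulrBr mulrN mulr1 mulNr; lra.
Qed.

End Bump.

(** Finiteness of the generating set enters here: a single [K] serves all generators, so [rho] can
    be chosen after them. *)
Lemma finite_exponent_bound (n : nat) (X : eqType)
    (s : seq X) (T : X -> 'rV[int]_n -> 'rV[int]_n -> Prop) :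
  (forall x, x \in s -> exists u v, T x u v) ->
  exists K : nat, forall x, x \in s ->
    exists u v, T x u v /\ forall i, `|(u - v) 0 i| <= K%:Z.
Proof.
elim: s => [|x s IH] sT; first by exists 0%N.
have [|K KP] := IH; first by move=> y ys; apply: sT; rewrite inE ys orbT.
have [u [v Tuv]] := sT x (mem_head _ _).
pose L := (\sum_(i < n) absz ((u - v)%R 0%R i))%N.
have LP i : `|(u - v) 0 i| <= L%:Z.
  by rewrite -abszE lez_nat /L (bigD1 i)//= leq_addr.
exists (K + L)%N => y; rewrite inE => /predU1P[->|/KP[u' [v' [Tuv' K']]]].
  by exists u, v; split=> // i; have := LP i; lia.
by exists u', v'; split=> // i; have := K' i; lia.
Qed.

(** * Rigidity of the class of f and the contradiction *)

Unset Implicit Arguments.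

Theorem theorem1p2 (R : realType) (n : nat) (n_ge2 : (2 <= n)%N)
    (Z : set 'rV[R]_n) (Z_proper : Z `<` setT) (Z_closed : closed Z)
    (Z_unbounded : unbounded_in_all_rational_directions Z) :
  ~ finitely_generated (congruence_of Z).
Proof.
case: n n_ge2 Z Z_proper Z_closed Z_unbounded => [|[|n]]// _ Z Z_proper Zc Zu.
move=> [G /finite_seqP[s Gs] EG].
have sE ab : ab \in s -> congruence_of Z ab.
  by move=> abs; rewrite EG => E [_]; apply; rewrite Gs.
(* Both sides of each generator are listed, since a generator can be applied in either direction. *)
pose F := [seq a <- [seq ab.1 | ab <- s] ++ [seq ab.2 | ab <- s] |
  `[< exists b, congruence_of Z (a, b) /\ a <> b >]].
pose two (a : laurent_fcn R n.+2) u v :=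
  [/\ u != v, dominates_monomial a u & dominates_monomial a v].
have [a|K KP] := @finite_exponent_bound n.+2 _ F two.
  rewrite mem_filter => /andP[/asboolP[b [ab nab]] _].
  exact: dominates_two ab nab.
have [rho [w [rw1 rhoK]]] := primitive_functional n K.
have [S [S0 Srho [L L0 LP]]] := thin_cross_polytope (R := R) rw1.
have [p0 Zp0] : exists p0, ~ Z p0.
  by apply/existsNP => ZT; case: Z_proper => _; apply => p _; exact: ZT.
(* As [Z] is closed, a sup-norm ball of radius [dl] around [p0] misses it. *)
have [dl dl0 dlP] : exists2 dl : R, 0 < dl &
    forall p, Z p -> exists j, dl <= `|(p - p0) 0 j|.
  have /nbhs_ballP[dl dl0 dlP] : nbhs p0 (~` Z).
    by apply: open_nbhs_nbhs; split=> //; exact: closed_openC.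
  exists dl => // p Zp; apply: contrapT => /forallNP pdl.
  apply: (dlP p) => //; split=> // i j; rewrite (ord1 i) /ball/= distrC.
  by have /negP := pdl j; rewrite -ltNge !mxE.
(* By [LP], if all |u . (p - p0)| were below [dl / L], then p would be within [dl] of [p0]; so f >=
   dl / L on [Z]. *)
pose f := cross_fcn p0 S; pose g := f + const_fcn (dl / L).
have gE p : g p = f p + Some (dl / L) by [].
have fg : congruence_of Z (f, g).
  move=> p Zp; suff: f p = f p + Some (dl / L) by [].
  have [j dlj] := dlP p Zp.
  have [u uS dlu] : exists2 u, u \in S & dl / L <= `|dotp (map_mx intr u) (p - p0)|.
    apply: contrapT => Nu; move: dlj; apply/negP; rewrite -ltNge.
    rewrite -[dl](mulfVK (lt0r_neq0 L0)) mulrC; apply: LP => u uS.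
    by rewrite ltNge; apply: contra_notN Nu => dlu; exists u.
  have [y -> uy] := cross_fcn_ge p0 p uS.
  by apply/(congr1 Some)/esym/max_idPl; exact: le_trans uy.
(* If c <> 0 dominates x, then f dominates x + u and x + v for two exponents of a; [rho] differs on
   them by at least 3, but f allows at most 2. *)
have rigid a b c e : (a, b) \in s \/ (b, a) \in s -> c * a + e = f ->
    c * b + e = f.
  move=> ab caef; have [<-//|nab] := pselect (a = b).
  have Eab : congruence_of Z (a, b).
    by case: ab => /sE// ba p Zp; exact: esym (ba p Zp).
  have [c0|c0] := pselect (c = 0); first by move: caef; rewrite c0 !mul0r.
  have aF : a \in F.
    rewrite mem_filter mem_cat; apply/andP; split; first by apply/asboolP; exists b.
    by case: ab => [/(map_f fst)->//|/(map_f snd)->]; rewrite orbT.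
  have [u [v [[uv au av] uvK]]] := KP a aF.
  have [x cx] := dominates_nonzero c0.
  have fx z : dominates_monomial a z -> dominates_monomial f (x + z).
    by move=> az; rewrite -caef; apply/dominates_add/dominates_mul.
  have := cross_fcn_dominates Srho (fx _ au) (fx _ av).
  rewrite [x + u]addrC opprD addrA addrK => /le_lt_trans-/(_ 3 isT).
  by rewrite ltNge rhoK ?subr_eq0.
(* By rigidity the congruence isolating [f] contains the generators, hence (f, g); c = 1 and e = 0
   then give g = f. *)
have := fg; rewrite EG => /(_ _ (conj (syntactic_is_congruence f) _))/=.
move=> /(_ _ 1 0)[|+ _]; first by case=> a b; rewrite Gs => abs c e; split=>
  /=; apply: rigid; [left|right].
rewrite !mul1r !addr0 => /(_ erefl) gf.
(* All forms u . (p - p0) vanish at [p0], whereas [g p0] is at least [dl / L]. *)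
have [y fy0] : exists2 y, f p0 = Some y & y <= 0.
  have [u uS] : exists u, u \in S.
    by move: S0; clear; case: S => // u S' _; exists u; rewrite mem_head.
  have [y yE _] := cross_fcn_ge p0 p0 uS; exists y => //.
  apply: cross_fcn_le yE => v _; rewrite subrr dotpC /dotp big1 ?normr0// => i _.
  by rewrite mxE mul0r.
have := congr1 (fun h : laurent_fcn R n.+2 => h p0) gf.
rewrite gE fy0 => -[] yE.
have : dl / L <= y by rewrite -yE le_max lexx orbT.
have : 0 < dl / L by rewrite divr_gt0.
lra.
Qed.
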